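(* Let $M,N\in\mathbb N$ and let $m_0:X\to\mathbb C$ satisfy: (P1) $m_0$ is constant on cosets $K_{-N}^\perp\zeta$, $\zeta\in X$; (P2) $m_0$ is periodic with any period $\mathbf r_1^{\alpha_1}\mathbf r_2^{\alpha_2}\cdots\mathbf r_l^{\alpha_l}$, i.e. $m_0(\chi\,\mathbf r_1^{\alpha_1}\mathbf r_2^{\alpha_2}\cdots\mathbf r_l^{\alpha_l})=m_0(\chi)$ for all $\chi\in X$, $l\in\mathbb N$, $\alpha_j\in GF(p^s)$; (P3) $m_0(K_{-N}^\perp)=1$, i.e. $m_0(\chi)=1$ for $\chi\in K_{-N}^\perp$. Then $m_0$ is a mask of some equation on the class $\mathfrak D_{-N}(K_M^\perp)$, i.e. there exists $\hat\varphi\in\mathfrak D_{-N}(K_M^\perp)$ for which $$\hat\varphi(\chi)=m_0(\chi)\hat\varphi(\chi\mathcal A^{-1}),$$ if and only if $$m_0(\chi)\,m_0(\chi\mathcal A^{-1})\cdots m_0(\chi\mathcal A^{-M-N})=0$$ on $K_{M+1}^\perp\setminus K_M^\perp$.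
   Context: $\mathbb N=\{1,2,\dots\}$; $p$ is a prime, $s\in\mathbb N$. $GF(p^s)$ is the finite field of $p^s$ elements, realized as vectors $\mathbf a=(a^{(0)},\dots,a^{(s-1)})$ with $a^{(l)}\in GF(p)=\{0,\dots,p-1\}$; addition is coordinatewise mod $p$, multiplication is multiplication of the polynomials $\sum_l a^{(l)}t^l$ over $GF(p)$ modulo a fixed irreducible polynomial of degree $s$. $K=F^{(s)}$ is the local field of characteristic $p$ consisting of sequences $a=(\mathbf a_j)_{j\in\mathbb Z}$, $\mathbf a_j\in GF(p^s)$, with only finitely many nonzero $\mathbf a_j$ with $j<0$; addition is coordinatewise and multiplication is convolution. $K_n=\{a\in K:\mathbf a_j=\mathbf 0\ \forall j<n\}$, $n\in\mathbb Z$, is a neighbourhood basis of zero consisting of compact subgroups of the additive group $K^+$. The dilation operator is $(\mathcal A a)_n=\mathbf a_{n+1}$. $X$ is the group of continuous characters of $K^+$, $(\chi,x)=\chi(x)$. For $k\in\mathbb Z$, $\mathbf u\in GF(p^s)$, $\mathbf r_k^{\mathbf u}\in X$ is $\mathbf r_k^{\mathbf u}(x)=\prod_{l=0}^{s-1}\exp\left(\frac{2\pi i}{p}u^{(l)}x_k^{(l)}\right)$, where $x=(\mathbf x_k)$, $\mathbf x_k=(x_k^{(0)},\dots,x_k^{(s-1)})$. $K_n^\perp=\{\chi\in X:\chi(x)=1\ \forall x\in K_n\}$. For $\chi\in X$ and $n\in\mathbb Z$, $\chi\mathcal A^n$ is defined by $(\chi\mathcal A^n,x)=(\chi,\mathcal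 A^nx)$. $\mathfrak D_{-N}(K_M^\perp)$ is the set of step functions $f\in L_2(X)$ with $\operatorname{supp}f\subset K_M^\perp$ that are constant on cosets $K_{-N}^\perp\zeta$, $\zeta\in X$.
   Formalization: The solution φ̂ is required to be not identically zero; with φ̂ = 0 allowed, m_0 ≡ 1 satisfies (P1)–(P3) and has a solution although the product equals 1 on K_{M+1}^⊥∖K_M^⊥, so the ''only if'' part would fail. *)

(* Defs.v *)
From HB Require Import structures.
From mathcomp Require Import all_boot all_order all_algebra all_field.
From mathcomp Require Import all_classical all_reals all_analysis.
From mathcomp Require Import complex zify.

Set Implicit Arguments.
Unset Strict Implicit.
Unset Printing Implicit Defensive.

Import Order.TTheory GRing.Theory Num.Theory.
Import numFieldNormedType.Exports.

Local Open Scope classical_set_scope.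
Local Open Scope ring_scope.

(* The local field F((t)) as coefficient sequences.  Only its additive
   topological group K^+ is equipped with structure: convolution plays no role
   in characters, dilations or cosets. *)

Record laurent (F : finFieldType) : Type := Laurent {
  coef :> int -> F;
  coef_finite : finite_set [set j : int | j < 0 /\ coef j != 0] }.

HB.instance Definition _ (F : finFieldType) := gen_eqMixin (laurent F).
HB.instance Definition _ (F : finFieldType) := gen_choiceMixin (laurent F).

Section LaurentGroup.
Variable F : finFieldType.
Implicit Types a b c : laurent F.

Lemma laurentP a b : (forall j, a j = b j) -> a = b.
Proof.
case: a b => [a fa] [b fb] /= /funext ab; subst b.
by rewrite (Prop_irrelevance fa fb).
Qed.

Lemma zerol_finite : finite_set [set j : int | j < 0 /\ (0 : F) != 0].
Proof. by apply: (sub_finite_set _ (finite_set0 _)) => j [_]; rewrite eqxx. Qed.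

Lemma oppl_finite a : finite_set [set j : int | j < 0 /\ - a j != 0].
Proof.
by apply: (sub_finite_set _ (coef_finite a)) => j [? ?]; rewrite /= -oppr_eq0.
Qed.

Lemma addl_finite a b : finite_set [set j : int | j < 0 /\ a j + b j != 0].
Proof.
apply: (@sub_finite_set _ _
  ([set j | j < 0 /\ a j != 0] `|` [set j | j < 0 /\ b j != 0])); last first.
  by rewrite finite_setU; split; apply: coef_finite.
move=> j [j0 abj] /=; case: (eqVneq (a j) 0) => [aj|]; last by left.
by right; rewrite aj add0r in abj.
Qed.

Definition zerol : laurent F := Laurent zerol_finite.
Definition oppl a : laurent F := Laurent (oppl_finite a).
Definition addl a b : laurent F := Laurent (addl_finite a b).

Lemma addlA : associative addl.
Proof. by move=> a b c; apply: laurentP => j /=; rewrite addrA. Qed.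
Lemma addlC : commutative addl.
Proof. by move=> a b; apply: laurentP => j /=; rewrite addrC. Qed.
Lemma add0l : left_id zerol addl.
Proof. by move=> a; apply: laurentP => j /=; rewrite add0r. Qed.
Lemma addNl : left_inverse zerol oppl addl.
Proof. by move=> a; apply: laurentP => j /=; rewrite addNr. Qed.

HB.instance Definition _ := GRing.isZmodule.Build (laurent F)
  addlA addlC add0l addNl.

Lemma laurent_addE a b j : (a + b) j = a j + b j. Proof. by []. Qed.
Lemma laurent_oppE a j : (- a) j = - a j. Proof. by []. Qed.

(* K_n *)
Definition Kball (n : int) : set (laurent F) :=
  [set a | forall j : int, j < n -> a j = 0].

Definition laurent_nbhs a : set_system (laurent F) :=
  filter_from setT (fun n : int => [set b | Kball n (b - a)]).

HB.instance Definition _ := hasNbhs.Build (laurent F) laurent_nbhs.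

Lemma laurent_nbhs_filter a : ProperFilter (nbhs a).
Proof.
apply: filter_from_proper; last first.
  by move=> n _; exists a => j _; rewrite subrr.
apply: filter_from_filter; first by exists 0.
move=> m n _ _; exists (Order.max m n) => // b Kb.
by split=> j jn; apply: Kb; rewrite lt_max jn ?orbT.
Qed.

Lemma laurent_nbhs_singleton a (A : set (laurent F)) : nbhs a A -> A a.
Proof. by case=> n _; apply => j _; rewrite subrr. Qed.

Lemma laurent_nbhs_nbhs a (A : set (laurent F)) : nbhs a A -> nbhs a (nbhs^~ A).
Proof.
case=> n _ nA; exists n => // b Kb; exists n => // c Kc; apply: nA => j jn.
by rewrite -(subrKA b) laurent_addE Kc // Kb // addr0.
Qed.

HB.instance Definition _ := Nbhs_isNbhsTopological.Build (laurent F)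
  laurent_nbhs_filter laurent_nbhs_singleton laurent_nbhs_nbhs.

(* [dil n] is the n-th power of the dilation operator [dil 1], n in Z *)
Lemma dil_finite (n : int) a : finite_set [set j : int | j < 0 /\ a (j + n) != 0].
Proof.
apply: (@sub_finite_set _ _
  ((fun j => j - n) @` [set j | j < 0 /\ a j != 0] `|`
   (fun k : nat => k%:Z - n) @` `I_(absz n))); last first.
  rewrite finite_setU; split; apply: finite_image => //.
  exact: coef_finite.
move=> j [j0 ajn] /=; case: (ltP (j + n) 0) => jn.
  by left; exists (j + n); rewrite ?addrK.
right; exists (absz (j + n)); last by rewrite gez0_abs // addrK.
by rewrite /=; lia.
Qed.

Definition dil (n : int) a : laurent F := Laurent (dil_finite n a).

Lemma dil0 a : dil 0 a = a.
Proof. by apply: laurentP => j /=; rewrite addr0. Qed.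
Lemma dil_add (m n : int) a : dil (m + n) a = dil m (dil n a).
Proof. by apply: laurentP => j /=; rewrite addrA. Qed.

End LaurentGroup.

(* The cast to numFieldType selects the topology of R[i] given by its norm. *)
Record character (R : realType) (F : finFieldType) : Type := Character {
  char_val :> laurent F -> R[i];
  charD : forall x y, char_val (x + y) = char_val x * char_val y;
  char_norm : forall x, `|char_val x| = 1;
  char_continuous :
    continuous (char_val : laurent F -> (R[i] : numFieldType)) }.

HB.instance Definition _ R F := gen_eqMixin (character R F).
HB.instance Definition _ R F := gen_choiceMixin (character R F).

Section Characters.
Variables (R : realType) (F : finFieldType).
Implicit Types chi zeta eta : character R F.

Lemma characterP chi zeta : (forall x, chi x = zeta x) -> chi = zeta.
Proof.
case: chi zeta => [f f1 f2 f3] [g g1 g2 g3] /= /funext fg; subst g.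
by rewrite (Prop_irrelevance f1 g1) (Prop_irrelevance f2 g2)
           (Prop_irrelevance f3 g3).
Qed.

Lemma char_neq0 chi x : chi x != 0.
Proof. by rewrite -normr_eq0 char_norm oner_eq0. Qed.

Lemma char1D (x y : laurent F) : (1 : R[i]) = 1 * 1.
Proof. by rewrite mulr1. Qed.
Lemma char1_norm (x : laurent F) : `|1 : R[i]| = 1.
Proof. exact: normr1. Qed.
Lemma char1_continuous :
  continuous ((fun=> 1) : laurent F -> (R[i] : numFieldType)).
Proof. exact: (@cst_continuous _ (R[i] : numFieldType)). Qed.
Definition char1 : character R F :=
  Character char1D char1_norm char1_continuous.

Lemma charMD chi zeta x y :
  chi (x + y) * zeta (x + y) = (chi x * zeta x) * (chi y * zeta y).
Proof. by rewrite !charD mulrACA. Qed.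
Lemma charM_norm chi zeta x : `|chi x * zeta x| = 1.
Proof. by rewrite normrM !char_norm mulr1. Qed.
Lemma charM_continuous chi zeta :
  continuous ((fun x => chi x * zeta x)
    : laurent F -> (R[i] : numFieldType)).
Proof.
by move=> x; apply: (@continuousM (R[i] : numFieldType));
  apply: char_continuous.
Qed.
Definition charM chi zeta : character R F :=
  Character (charMD chi zeta) (charM_norm chi zeta) (@charM_continuous chi zeta).

Lemma charVD chi x y : (chi (x + y))^-1 = (chi x)^-1 * (chi y)^-1.
Proof. by rewrite charD invfM. Qed.
Lemma charV_norm chi x : `|(chi x)^-1| = 1.
Proof. by rewrite normfV char_norm invr1. Qed.
Lemma charV_continuous chi :
  continuous ((fun x => (chi x)^-1) : laurent F -> (R[i] : numFieldType)).
Proof.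
by move=> x; apply: (@continuousV (R[i] : numFieldType));
  [apply: char_neq0 | apply: char_continuous].
Qed.
Definition charV chi : character R F :=
  Character (charVD chi) (charV_norm chi) (@charV_continuous chi).

Lemma charMA : associative charM.
Proof. by move=> a b c; apply: characterP => x /=; rewrite mulrA. Qed.
Lemma char1M : left_id char1 charM.
Proof. by move=> a; apply: characterP => x /=; rewrite mul1r. Qed.
Lemma charM1 : right_id char1 charM.
Proof. by move=> a; apply: characterP => x /=; rewrite mulr1. Qed.
Lemma charVM : left_inverse char1 charV charM.
Proof.
by move=> a; apply: characterP => x /=; rewrite mulVf // char_neq0.
Qed.
Lemma charMV : right_inverse char1 charV charM.
Proof.
by move=> a; apply: characterP => x /=; rewrite mulfV // char_neq0.
Qed.

HB.instance Definition _ := isGroup.Build (character R F)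
  charMA char1M charM1 charVM charMV.

Lemma char_mulE chi zeta x : (chi * zeta)%g x = chi x * zeta x.
Proof. by []. Qed.
Lemma char_oneE x : (1%g : character R F) x = 1.
Proof. by []. Qed.

Lemma char_dilD chi (n : int) x y :
  chi (dil n (x + y)) = chi (dil n x) * chi (dil n y).
Proof. by rewrite -charD; congr (chi _); apply: laurentP. Qed.
Lemma char_dil_norm chi (n : int) x : `|chi (dil n x)| = 1.
Proof. exact: char_norm. Qed.
Lemma char_dil_continuous chi (n : int) :
  continuous ((fun x => chi (dil n x))
    : laurent F -> (R[i] : numFieldType)).
Proof.
move=> x; apply: (@continuous_comp _ _ (R[i] : numFieldType) (dil n) chi);
  last exact: char_continuous.
move=> A [m _ mA]; exists (m + n) => // y Ky; apply: mA => j jm /=.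
by apply: Ky; rewrite ltrD2r.
Qed.

(* chi A^n : precomposition with the n-th power of the dilation, so that
   K_n^perp A = K_(n+1)^perp. *)
Definition char_dil chi (n : int) : character R F :=
  Character (char_dilD chi n) (char_dil_norm chi n) (@char_dil_continuous chi n).

(* K_n^perp *)
Definition annih (n : int) : set (character R F) :=
  [set chi | forall x, Kball n x -> chi x = 1].

(* K_n^perp zeta *)
Definition perp_coset (n : int) zeta : set (character R F) :=
  [set (kappa * zeta)%g | kappa in annih n].

Definition constant_on_cosets (n : int) (f : character R F -> R[i]) :=
  forall zeta chi1 chi2, perp_coset n zeta chi1 -> perp_coset n zeta chi2 ->
    f chi1 = f chi2.

HB.instance Definition _ := isPointed.Build (character R F) 1%g.

(* The cosets of the K_n^perp form a countable base of the topology of X, so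
   they generate its Borel sigma-algebra. *)
Definition perp_cosets : set (set (character R F)) :=
  [set A | exists n zeta, A = perp_coset n zeta].

Notation borelX := (g_sigma_algebraType perp_cosets).

(* Translation invariant, nonzero and finite on the compact open subgroup
   K_0^perp; the normalization of the Haar measure is left free. *)
Definition is_haar (mu : {measure set borelX -> \bar R}) : Prop :=
  (forall zeta (A : set borelX), measurable A ->
     mu [set (zeta * chi)%g | chi in A] = mu A) /\
  (0 < mu (annih 0) < +oo)%E.

Definition sqr_integrable (mu : {measure set borelX -> \bar R})
    (f : character R F -> R[i]) : Prop :=
  [/\ measurable_fun setT (fun chi : borelX => complex.Re (f chi)),
      measurable_fun setT (fun chi : borelX => complex.Im (f chi)) &
      (\int[mu]_chi
         (complex.Re (f chi) ^+ 2 + complex.Im (f chi) ^+ 2)%:E < +oo)%E].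

(* D_n(K_m^perp), used with n = -N: constancy on the cosets of K_n^perp
   together with the support condition makes f a step function, as only
   finitely many cosets of K_n^perp lie in K_m^perp.  The set where f is nonzero
   is a union of such cosets, hence closed: it is the support of f. *)
Definition step_class (mu : {measure set borelX -> \bar R}) (n m : int)
    (f : character R F -> R[i]) : Prop :=
  [/\ sqr_integrable mu f,
      [set chi | f chi != 0] `<=` annih m &
      constant_on_cosets n f].

End Characters.

Notation borelX R F := (g_sigma_algebraType (@perp_cosets R F)).

(* Elements of [{poly %/ h with hI}] are the polynomials of degree < deg h
   over 'F_p, added coefficientwise and multiplied modulo h. *)
Section Rademacher.
Variables (R : realType) (p : nat) (h : {poly 'F_p}).
Variable hI : monic_irreducible_poly h.
Local Notation GF := {poly %/ h with hI}.

Definition coord (u : GF) (l : nat) : nat :=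
  nat_of_ord (u : {poly 'F_p})`_l.

Definition expi (theta : R) : R[i] := (cos theta +i* sin theta)%C.

Lemma expiD (a b : R) : expi (a + b) = expi a * expi b.
Proof.
by rewrite /expi cosD sinD; apply/eqP; rewrite eq_complex /= eqxx /= addrC.
Qed.

Lemma expi0 : expi 0 = 1. Proof. by rewrite /expi cos0 sin0. Qed.

Lemma expi_norm (a : R) : `|expi a| = 1.
Proof. by rewrite normc_def /= cos2Dsin2 sqrtr1. Qed.

Lemma expi_nat (a : R) (n : nat) : expi (a * n%:R) = expi a ^+ n.
Proof.
elim: n => [|n IHn]; first by rewrite mulr0 expi0.
by rewrite exprS -IHn -natr1 mulrDr mulr1 addrC expiD.
Qed.

Lemma expi_2pi : expi (2 * pi) = 1.
Proof. by rewrite /expi mulrC mulr_natr cos2pi sin2pi. Qed.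

Definition rchar_val (k : int) (u : GF) (x : laurent GF) : R[i] :=
  \prod_(l < (size h).-1) expi (2 * pi / p%:R * (coord u l * coord (x k) l)%:R).

Hypothesis pP : prime p.

Lemma rcharD k u x y :
  rchar_val k u (x + y) = rchar_val k u x * rchar_val k u y.
Proof.
rewrite -big_split /=; apply: eq_bigr => l _; rewrite -expiD -mulrDr -natrD.
rewrite -mulnDr !expi_nat !exprM.
set z := expi _; have zp : (z ^+ coord u l) ^+ p = 1.
  rewrite exprAC /z -expi_nat divfK ?expi_2pi ?expr1n //.
  by rewrite pnatr_eq0 -lt0n prime_gt0.
have -> : coord (x k + y k) l = ((coord (x k) l + coord (y k) l) %% p)%N.
  by rewrite /coord /= coefD /= [X in (_ %% X)%N = _]Fp_cast.
by rewrite expr_mod.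
Qed.

Lemma rchar_norm k u x : `|rchar_val k u x| = 1.
Proof. by rewrite normr_prod big1 // => l _; rewrite expi_norm. Qed.

Lemma rchar_continuous k u :
  continuous (rchar_val k u : laurent GF -> (R[i] : numFieldType)).
Proof.
move=> x A /nbhs_singleton Ax; exists (k + 1) => // y Ky /=.
have -> : rchar_val k u y = rchar_val k u x; last exact: Ax.
apply: eq_bigr => l _; congr (expi (_ * (_ * coord _ _)%:R)).
apply/eqP; rewrite -subr_eq0 -laurent_oppE -laurent_addE.
by apply/eqP/Ky; rewrite ltzD1.
Qed.

(* the character r_k^u *)
Definition rchar k u : character R GF :=
  Character (rcharD k u) (rchar_norm k u) (@rchar_continuous k u).

End Rademacher.

(* Main.v *)
Require Import Defs.
From mathcomp Require Import all_boot all_order all_algebra all_field.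
From mathcomp Require Import all_classical all_reals all_analysis.
From mathcomp Require Import complex.
From mathcomp Require Import measurable_realfun zify.

Import Order.TTheory GRing.Theory Num.Theory.
Local Open Scope classical_set_scope.
Local Open Scope ring_scope.

(** Write A for the dilation.  Composing a character with A^-1 shrinks it: it
    maps K_(n+1)^perp into K_n^perp.  Hence iterating the refinement equation
    phi(chi) = m0(chi) phi(chi A^-1) gives, for every j,

      phi(chi) = m0(chi) m0(chi A^-1) ... m0(chi A^-(j-1)) phi(chi A^-j)

    ([refinement_iter]), and as soon as chi A^-j lies in K_(-N)^perp the last
    factor is the constant c = phi(1).

    Suppose a nonzero solution phi exists.  It is nonzero at some point of
    K_M^perp, and the displayed identity with j = M + N gives c != 0.  On
    K_(M+1)^perp minus K_M^perp the left side vanishes because of the support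
    of phi, so with j = M + N + 1 the product of the values of m0 is 0.

    Conversely, let phi be the product of the first M + N factors on K_M^perp
    and 0 elsewhere.  Inside K_M^perp the extra factor m0(chi A^-(M+N)) that
    the refinement equation brings in is evaluated on K_(-N)^perp, so it is 1.
    Outside K_(M+1)^perp both sides of the equation are 0, since chi A^-1 is
    still outside K_M^perp.  On the remaining shell K_(M+1)^perp minus K_M^perp
    the right side is exactly the product assumed to vanish.

    There remains phi in L_2(X).  A character in K_m^perp is determined modulo
    K_n^perp by its values on finitely many Laurent polynomials
    ([char_window]), and these values are p-th roots of unity, p the
    characteristic ([char_values]); so K_m^perp is covered by finitely many
    cosets of K_n^perp ([perp_transversal]).  Hence phi is measurable and
    bounded, and K_M^perp has finite Haar measure. *)

(** * Annihilators of the balls and their cosets *)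

Section Annihilators.
Set Implicit Arguments.
Unset Strict Implicit.

Variables (R : realType) (F : finFieldType).
Implicit Types (chi zeta : character R F) (m n : int) (x : laurent F).

Lemma Kball_le n m x : n <= m -> Kball m x -> Kball n x.
Proof. by move=> nm Kx j jn; apply: Kx; apply: lt_le_trans nm. Qed.

Lemma annih_le n m : n <= m -> @annih R F n `<=` annih m.
Proof. by move=> nm chi Hchi x Kx; apply/Hchi/(Kball_le nm). Qed.

Lemma char_dil0 chi : char_dil chi 0 = chi.
Proof. by apply: characterP => x /=; rewrite dil0. Qed.

Lemma char_dilD chi m n : char_dil (char_dil chi m) n = char_dil chi (m + n).
Proof. by apply: characterP => x /=; rewrite dil_add. Qed.

Lemma Kball_dil m n x : Kball m (dil n x) <-> Kball (m + n) x.
Proof.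
split=> Kx j jm /=; last by apply: Kx; rewrite ltrD2r.
by have := Kx (j - n); rewrite /= subrK; apply; rewrite ltrBlDr.
Qed.

Lemma annih_dil m n chi : annih m (char_dil chi n) <-> annih (m - n) chi.
Proof.
split=> Hchi x Kx.
  rewrite -[x]dil0 -(subrr n) dil_add; apply: Hchi.
  exact/Kball_dil.
by apply: Hchi; apply/Kball_dil; rewrite subrK.
Qed.

(** Two characters lie in the same coset of K_n^perp exactly when they agree on
    K_n; all constancy and saturation arguments below use this form. *)
Lemma perp_cosetP n zeta chi :
  perp_coset n zeta chi <-> forall x, Kball n x -> chi x = zeta x.
Proof.
split=> [[kappa Hkappa <-] x Kx|eqx].
  by rewrite char_mulE Hkappa // mul1r.
exists (chi * zeta^-1)%g; last by rewrite mulgVK.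
by move=> x Kx; rewrite char_mulE eqx // divff // char_neq0.
Qed.

Lemma perp_coset1 n : @perp_coset R F n 1%g = annih n.
Proof.
by apply/seteqP; split=> chi; [move/perp_cosetP|move=> ?; apply/perp_cosetP].
Qed.

(** * Finiteness of the quotients of annihilators *)

Definition window_coef n (d : nat) (c : {ffun 'I_d -> F}) (j : int) : F :=
  if n <= j then oapp c 0 (insub `|j - n|%N) else 0.

Lemma window_coef_finite n d (c : {ffun 'I_d -> F}) :
  finite_set [set j : int | j < 0 /\ window_coef n c j != 0].
Proof.
apply: (@sub_finite_set _ _ ((fun k : nat => n + k%:Z) @` `I_d)); last first.
  exact/finite_image/finite_II.
move=> j [_]; rewrite /window_coef; case: ifP => [nj|]; last by rewrite eqxx.
case: insubP => [k + _ _|]; last by rewrite eqxx.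
by exists `|j - n|%N => //; rewrite gez0_abs ?subr_ge0 // subrKC.
Qed.

Definition window_laurent n d (c : {ffun 'I_d -> F}) : laurent F :=
  Laurent (window_coef_finite n c).

(** Truncating x at n + d changes it by an element of K_(n+d), on which chi is
    trivial; so chi is known on K_n from finitely many values. *)
Lemma char_window n d chi x : annih (n + d%:Z) chi -> Kball n x ->
  chi x = chi (window_laurent n [ffun k : 'I_d => x (n + k%:Z)]).
Proof.
move=> Hchi Kx; set w := window_laurent _ _.
rewrite -[x](subrK w) charD Hchi ?mul1r // => j jd.
rewrite laurent_addE laurent_oppE /= /window_coef.
case: ifP => [nj|/negbT]; last by rewrite -ltNge => /Kx ->; rewrite subrr.
case: insubP => [k _ kE /=|]; last by lia.
by rewrite ffunE kE gez0_abs ?subr_ge0 // subrKC subrr.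
Qed.

(** The additive group of Laurent series is killed by the characteristic p of
    the coefficients, so characters take their values in the roots of
    X^p - 1. *)
Lemma char_values : exists rs : seq R[i], forall chi x, chi x \in rs.
Proof.
have [p pP pF] := finPcharP F.
have [rs rsE] := closed_field_poly_normal ('X^p - 1 : {poly R[i]}).
exists rs => chi x.
have chi0 : chi 0 = 1.
  by apply: (mulfI (char_neq0 chi 0)); rewrite -charD addr0 mulr1.
have chi_exp k : chi (x *+ k) = chi x ^+ k.
  by elim: k => [|k IHk]; rewrite ?chi0 // mulrS charD IHk exprS.
have xp : x *+ p = 0.
  have xE k j : (x *+ k) j = x j *+ k.
    by elim: k => [//|k IHk]; rewrite !mulrS laurent_addE IHk.
  by apply: laurentP => j; rewrite xE -mulr_natr (pcharf0 pF) mulr0.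
have : root ('X^p - 1) (chi x).
  by rewrite rootE !hornerE -chi_exp xp chi0 subrr.
by rewrite rsE (monicP _) ?scale1r ?root_prod_XsubC // monicXnsubC ?prime_gt0.
Qed.

(** Finite index of K_n^perp in K_m^perp: each class is labelled by the table of
    values on windows of width m - n, and there are finitely many tables. *)
Lemma perp_transversal n m : n <= m -> exists ts : seq (character R F),
  forall chi, annih m chi -> exists2 t, t \in ts & perp_coset n t chi.
Proof.
move=> nm; have mE : m = n + `|m - n|%N%:Z by lia.
move: `|m - n|%N mE => d ->; have [rs rsP] := char_values.
(* A table k of indices in rs determines at most one coset; tables that no
   character realizes contribute the default value of xget to the list. *)
pose cls (k : {ffun {ffun 'I_d -> F} -> 'I_(size rs)}) :=
  [set chi | annih (n + d%:Z) chi /\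
             forall c, chi (window_laurent n c) = rs`_(k c)].
exists [seq xget 1%g (cls k) | k : {ffun {ffun 'I_d -> F} -> 'I_(size rs)}].
move=> chi Hchi.
have idx (c : {ffun 'I_d -> F}) :
  (index (chi (window_laurent n c)) rs < size rs)%N.
  by rewrite index_mem.
pose k := [ffun c => Ordinal (idx c)].
have clsk : cls k chi by split=> // c; rewrite ffunE /= nth_index.
have [Ht tE] := xgetPex 1%g (ex_intro _ _ clsk).
exists (xget 1%g (cls k)); first by apply/mapP; exists k; rewrite ?mem_enum.
apply/perp_cosetP => x Kx.
by rewrite (char_window Hchi Kx) (char_window Ht Kx) tE clsk.2.
Qed.

End Annihilators.

(** * Step functions are square integrable *)

Section StepFunctions.
Set Implicit Arguments.
Unset Strict Implicit.

Variables (R : realType) (F : finFieldType).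
Implicit Types (chi zeta : character R F) (m n : int).

Lemma perp_coset_measurable n zeta :
  measurable (perp_coset n zeta : set (borelX R F)).
Proof. by apply: sub_sigma_algebra; exists n, zeta. Qed.

Lemma annih_measurable n : measurable (annih n : set (borelX R F)).
Proof. by rewrite -perp_coset1; apply: perp_coset_measurable. Qed.

(** Such a set is a finite union of cosets of K_n^perp, by finite index. *)
Lemma saturated_measurable n m (A : set (borelX R F)) : n <= m ->
  A `<=` annih m ->
  (forall chi zeta, perp_coset n zeta chi -> A chi <-> A zeta) ->
  measurable A.
Proof.
move=> nm AM Asat; have [ts tsP] := perp_transversal R F nm.
rewrite (_ : A = \big[setU/set0]_(t <- ts | `[< A t >]) perp_coset n t).
  by apply: bigsetU_measurable => t _; apply: perp_coset_measurable.
rewrite -bigcup_seq_cond; apply/seteqP.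
split=> [chi Achi|chi [t /andP[_ /asboolP At]]].
  have [t tts tchi] := tsP _ (AM _ Achi).
  by exists t => //; apply/andP; split=> //; apply/asboolP/(Asat _ _ tchi).
by move=> tchi; apply/(Asat _ _ tchi).
Qed.

Lemma step_measurable n m d (T : sigmaRingType d) (y : T)
    (f : character R F -> T) : n <= m ->
  (forall chi, ~ annih m chi -> f chi = y) ->
  (forall chi zeta, perp_coset n zeta chi -> f chi = f zeta) ->
  measurable_fun setT (f : borelX R F -> T).
Proof.
move=> nm fy fsat _ B mB; rewrite setTI.
rewrite -(setUIDK (f @^-1` B) (annih m)); apply: measurableU.
  apply: (@saturated_measurable n m) => // chi zeta zchi.
  rewrite /= (fsat _ _ zchi); have {zchi}/perp_cosetP zchi := zchi.
  split=> -[Bz Hm]; split=> // x Kx.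
    by rewrite -zchi ?Hm //; apply: Kball_le Kx.
  by rewrite zchi ?Hm //; apply: Kball_le Kx.
have [By|nBy] := pselect (B y).
  rewrite (_ : _ `\` _ = ~` annih m); last first.
    by apply/seteqP; split=> chi; [case|move=> nchi; split=> //=; rewrite fy].
  by apply: measurableC; apply: annih_measurable.
rewrite (_ : _ `\` _ = set0) //.
by apply/seteqP; split=> chi // -[] Bchi /fy fchi; rewrite /= fchi in Bchi.
Qed.

Variable mu : {measure set (borelX R F) -> \bar R}.
Hypothesis mu_haar : is_haar mu.

(** Finitely many translates of K_0^perp, all of the same measure, cover
    K_m^perp. *)
Lemma annih_measure_fin m : 0 <= m -> (mu (annih m) < +oo)%E.
Proof.
move=> m_ge0; have [ts tsP] := perp_transversal R F m_ge0.
pose U : set (borelX R F) := \big[setU/set0]_(t <- ts) perp_coset 0 t.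
have [mU Ufin] : measurable U /\ (mu U < +oo)%E.
  rewrite /U; apply: (big_ind (fun A : set (borelX R F) =>
    measurable A /\ (mu A < +oo)%E)) => [|A B [mA Afin] [mB Bfin]|t _].
  - by rewrite measure0.
  - split; first exact: measurableU.
    by apply: le_lt_trans (measureU2 mu mA mB) _; apply: lte_add_pinfty.
  - split; first exact: perp_coset_measurable.
    rewrite (_ : perp_coset 0 t = [set (t * chi)%g | chi in annih 0]).
      rewrite mu_haar.1; last exact: annih_measurable.
      by case/andP: mu_haar.2.
    apply: eq_imagel => kappa _.
    by apply: characterP => x; rewrite !char_mulE mulrC.
apply: le_lt_trans Ufin; apply: le_measure; rewrite ?inE //.
  exact: annih_measurable.
move=> chi /tsP[t tts tchi]; rewrite /U -bigcup_seq.
by exists t.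
Qed.

(** The values on representatives of the cosets bound the function, and its
    support has finite measure. *)
Lemma step_sqr_integrable n m (f : character R F -> R[i]) : n <= m -> 0 <= m ->
  (forall chi, ~ annih m chi -> f chi = 0) -> constant_on_cosets n f ->
  sqr_integrable mu f.
Proof.
move=> nm m_ge0 f0 fn.
have fsat chi zeta : perp_coset n zeta chi -> f chi = f zeta.
  by move=> zchi; apply: (fn zeta) => //; apply/perp_cosetP.
pose g chi : R := complex.Re (f chi) ^+ 2 + complex.Im (f chi) ^+ 2.
have g_ge0 chi : 0 <= g chi by rewrite addr_ge0 ?sqr_ge0.
have mg : measurable_fun setT (g : borelX R F -> R).
  apply: (@step_measurable n m _ _ (0 : R)) => // chi.
    by move=> /f0 E; rewrite /g E /= expr0n addr0.
  by move=> zeta /fsat E; rewrite /g E.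
have [ts tsP] := perp_transversal R F nm.
(* The sum over representatives dominates each term as g is nonnegative. *)
pose C := \sum_(t <- ts) g t.
have C_ge0 : 0 <= C by apply: sumr_ge0 => t _.
have gC chi : annih m chi -> g chi <= C.
  move=> /tsP[t tts /fsat E]; rewrite /C.
  rewrite (perm_big _ (perm_to_rem tts)) big_cons.
  by rewrite [g chi]/g E lerDl; apply: sumr_ge0 => u _.
split.
- apply: (@step_measurable n m _ _ (0 : R)) => //.
    by move=> chi /f0 ->.
  by move=> chi zeta /fsat ->.
- apply: (@step_measurable n m _ _ (0 : R)) => //.
    by move=> chi /f0 ->.
  by move=> chi zeta /fsat ->.
have -> : (\int[mu]_chi (g chi)%:E = \int[mu]_(chi in annih m) (g chi)%:E)%E.
  rewrite [RHS]integral_mkcond; apply: eq_integral => chi _.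
  rewrite patchE; case: ifPn => //; rewrite notin_setE => /f0 E.
  by rewrite /g E /= expr0n addr0.
apply: (@le_lt_trans _ _ (\int[mu]_(chi in annih m) cst C%:E chi)%E).
  apply: ge0_le_integral.
  - exact: annih_measurable.
  - by move=> chi _; rewrite lee_fin.
  - by apply/measurable_EFinP; apply: measurable_funS mg.
  - exact: measurable_cst.
  - by move=> chi /gC; rewrite lee_fin.
rewrite integral_cst; last exact: annih_measurable.
by apply: lte_mul_pinfty; rewrite ?lee_fin // annih_measure_fin.
Qed.

End StepFunctions.

(** * Iterating the refinement equation *)

Section IteratedMask.
Set Implicit Arguments.
Unset Strict Implicit.

Variables (R : realType) (F : finFieldType) (m0 : character R F -> R[i]).
Implicit Types (chi : character R F) (n : nat).

Definition iter_mask n chi : R[i] :=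
  \prod_(0 <= k < n) m0 (char_dil chi (- k%:Z)).

Lemma iter_maskS n chi :
  iter_mask n.+1 chi = m0 chi * iter_mask n (char_dil chi (- 1)).
Proof.
rewrite /iter_mask big_nat_recl // char_dil0; congr (_ * _).
by apply: eq_bigr => k _; rewrite char_dilD; congr (m0 (char_dil _ _)); lia.
Qed.

Lemma refinement_iter (phi : character R F -> R[i]) n chi :
  (forall chi, phi chi = m0 chi * phi (char_dil chi (- 1))) ->
  phi chi = iter_mask n chi * phi (char_dil chi (- n%:Z)).
Proof.
move=> ref; elim: n chi => [|n IHn] chi.
  by rewrite /iter_mask big_nil mul1r oppr0 char_dil0.
rewrite ref IHn iter_maskS mulrA char_dilD; congr (_ * phi (char_dil _ _)); lia.
Qed.

(** Precomposition with A^-k sends a coset of K_i^perp into a coset of the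
    smaller group K_(i-k)^perp, so each factor is constant. *)
Lemma iter_mask_cosets n (i : int) :
  constant_on_cosets i m0 -> constant_on_cosets i (iter_mask n).
Proof.
move=> m0N zeta chi1 chi2 /perp_cosetP E1 /perp_cosetP E2.
apply: eq_bigr => k _; apply: (m0N (char_dil zeta (- k%:Z)));
  apply/perp_cosetP => x Kx /=; [apply: E1|apply: E2];
  apply/Kball_dil; apply: Kball_le Kx; lia.
Qed.

End IteratedMask.

Theorem theorem6p2 (R : realType) (p s : nat) (pP : prime p)
    (s_gt0 : (0 < s)%N) (h : {poly 'F_p}) (hI : monic_irreducible_poly h)
    (deg_h : size h = s.+1)
    (mu : {measure set (borelX R {poly %/ h with hI}) -> \bar R})
    (mu_haar : is_haar mu)
    (M N : nat) (M_gt0 : (0 < M)%N) (N_gt0 : (0 < N)%N)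
    (m0 : character R {poly %/ h with hI} -> R[i])
    (P1 : constant_on_cosets (- N%:Z) m0)
    (P2 : forall (chi : character R {poly %/ h with hI}) (l : nat)
            (alpha : nat -> {poly %/ h with hI}), (0 < l)%N ->
          m0 (chi * \prod_(1 <= j < l.+1) rchar R pP j%:Z (alpha j))%g
          = m0 chi)
    (P3 : forall chi, annih (- N%:Z) chi -> m0 chi = 1) :
  (exists phi : character R {poly %/ h with hI} -> R[i],
     [/\ step_class mu (- N%:Z) M%:Z phi,
         exists chi, phi chi != 0 &
         forall chi, phi chi = m0 chi * phi (char_dil chi (- 1))])
  <->
  (forall chi, (annih M.+1%:Z `\` annih M%:Z) chi ->
     \prod_(0 <= k < (M + N).+1) m0 (char_dil chi (- k%:Z)) = 0).
Proof.
split=> [[phi [[_ supp phiN] [chi1 phi1] ref]] chi [Hchi nHchi]|zero].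
- have phi0 zeta : annih (- N%:Z) zeta -> phi zeta = phi 1%g.
    by move=> Hz; apply: (phiN 1%g); rewrite perp_coset1.
  have c0 : phi 1%g != 0.
    have Hchi1 := supp _ phi1; move: phi1.
    rewrite (refinement_iter (M + N) chi1 ref) mulf_eq0 negb_or => /andP[_].
    by rewrite phi0 //; apply/annih_dil; apply: annih_le Hchi1; lia.
  have : phi chi = 0 by apply/eqP; apply/negPn/negP => /supp.
  rewrite (refinement_iter (M + N).+1 chi ref) phi0; last first.
    by apply/annih_dil; apply: annih_le Hchi; lia.
  by move/eqP; rewrite mulf_eq0 (negbTE c0) orbF => /eqP.
- pose phi chi := if `[< annih M%:Z chi >] then iter_mask m0 (M + N) chi else 0.
  have phiN chi : ~ annih M%:Z chi -> phi chi = 0.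
    by rewrite /phi; case: asboolP.
  have phi_cst : constant_on_cosets (- N%:Z) phi.
    move=> zeta chi1 chi2 H1 H2; rewrite /phi (iter_mask_cosets _ P1 H1 H2).
    congr (if _ then _ else _); apply: asbool_equiv_eq.
    (* K_M is contained in K_(-N), where the two characters agree. *)
    have E x : Kball M%:Z x -> chi1 x = chi2 x.
      move=> Kx; have Kx' : Kball (- N%:Z) x by apply: Kball_le Kx; lia.
      by rewrite ((perp_cosetP _ _ _).1 H1) // ((perp_cosetP _ _ _).1 H2).
    by split=> H x Kx; [rewrite -E|rewrite E] => //; apply: H.
  exists phi; split.
  + split=> //; last first.
      move=> chi /= phi_n0; apply: contrapT => /phiN E.
      by rewrite E eqxx in phi_n0.
    by apply: (@step_sqr_integrable _ _ _ mu_haar (- N%:Z) M%:Z) => //; lia.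
  + exists 1%g; rewrite /phi asboolT // /iter_mask big1 ?oner_eq0 // => k _.
    by apply: P3; apply/annih_dil.
  + move=> chi; rewrite /phi; case: asboolP => [Hchi|nHchi].
      rewrite asboolT; last by apply/annih_dil; apply: annih_le Hchi; lia.
      rewrite -iter_maskS /iter_mask big_nat_recr //= P3 ?mulr1 //.
      by apply/annih_dil; apply: annih_le Hchi; lia.
    case: asboolP => [/annih_dil Hchi|_]; last by rewrite mulr0.
    rewrite -iter_maskS; apply/esym/zero; split=> //.
    by apply: annih_le Hchi; lia.
Qed.
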